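(* Let $s$ be a real number and let $\mu$ be a finite Borel measure on $\mathbb{R}^d$ such that \[ \sup_{\theta\in(0,1)}\frac{\dim_{\mathrm F}^{\theta}\mu}{\theta}\geq s . \] Then $\mu$ is Sobolev improving in the sense that for all finite Borel measures $\nu$ on $\mathbb{R}^d$ with $\dim_{\mathrm S}\nu<s$, \[ \dim_{\mathrm S}(\mu*\nu)>\dim_{\mathrm S}\nu . \]
   Context: $\mu*\nu$ denotes convolution of measures. For a finite Borel measure $\mu$ on $\mathbb{R}^d$ write $\widehat\mu(z)=\int e^{-2\pi i z\cdot x}\,d\mu(x)$. For $s\geq 0$ and $\theta\in(0,1]$ let $\mathcal{J}_{s,\theta}(\mu)=\left(\int_{\mathbb{R}^d}|\widehat\mu(z)|^{2/\theta}|z|^{s/\theta-d}\,dz\right)^{\theta}$. The Fourier spectrum of $\mu$ at $\theta\in(0,1]$ is $\dim_{\mathrm F}^{\theta}\mu=\sup\{s\geq 0:\mathcal{J}_{s,\theta}(\mu)<\infty\}\in[0,\infty]$, with $\sup\emptyset=0$, and $\dim_{\mathrm S}\mu=\dim_{\mathrm F}^{1}\mu$ is the Sobolev dimension. *)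

(* Defs.v *)
From HB Require Import structures.
From mathcomp Require Import all_boot all_order all_algebra.
From mathcomp Require Import complex.
From mathcomp Require Import all_classical all_reals all_analysis.
From mathcomp Require Import measurable_realfun.

Set Implicit Arguments.
Unset Strict Implicit.
Unset Printing Implicit Defensive.
Import Order.TTheory GRing.Theory Num.Theory.
Import numFieldNormedType.Exports.

Local Open Scope classical_set_scope.
Local Open Scope ring_scope.

Lemma sigma_finite_product d1 d2 (T1 : measurableType d1)
    (T2 : measurableType d2) (R : realType)
    (m1 : {sigma_finite_measure set T1 -> \bar R})
    (m2 : {sigma_finite_measure set T2 -> \bar R}) :
  sigma_finite setT (m1 \x m2)%E.
Proof.
have /sigma_finiteP[F [TF ndF Foo]] := sigma_finiteT m1.
have /sigma_finiteP[G [TG ndG Goo]] := sigma_finiteT m2.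
exists (fun n => F n `*` G n).
  rewrite -setXTT TF TG predeqE => -[x y]; split.
    move=> [/= [n _ Fnx] [k _ Gky]]; exists (maxn n k) => //; split.
    - by move: x Fnx; exact/subsetPset/ndF/leq_maxl.
    - by move: y Gky; exact/subsetPset/ndG/leq_maxr.
  by move=> [n _ []/= ? ?]; split; exists n.
move=> k; have [? ?] := Foo k; have [? ?] := Goo k.
split; first exact: measurableX.
by rewrite product_measure1E// lte_mul_pinfty// ge0_fin_numE.
Qed.

Section euclidean.
Context {R : realType}.
Implicit Types d : nat.

Definition dotpr d (x y : d.-tuple R) : R := \sum_(i < d) tnth x i * tnth y i.

Definition enorm d (x : d.-tuple R) : R := Num.sqrt (dotpr x x).

Definition addpt d (p : d.-tuple R * d.-tuple R) : d.-tuple R :=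
  [tuple tnth p.1 i + tnth p.2 i | i < d].

(* [lebesgue_measure] lives on [measurableTypeR R], whose sigma-algebra is
   convertible to the one of [R] but has another display. *)
Definition conspt d (p : d.-tuple R * measurableTypeR R) : d.+1.-tuple R :=
  [tuple of p.2 :: p.1].

Lemma measurable_addpt d : measurable_fun setT (@addpt d).
Proof.
apply/measurable_fun_tnthP => i /=.
rewrite (_ : _ \o _ = (fun p => tnth p.1 i + tnth p.2 i)); last first.
  by apply/funext => p /=; rewrite /addpt tnth_mktuple.
by apply: measurable_funD; apply: (measurableT_comp (measurable_tnth i)).
Qed.

Lemma measurable_conspt d : measurable_fun setT (@conspt d).
Proof.
apply: measurable_cons; last exact: measurable_fst.
by move=> mT Y mY; exact: (measurable_snd mT).
Qed.

(* Image of the iterated product measure; it is characterized on boxes by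
   [lebesgue_tuple_box]. *)
Fixpoint lebesgue_tuple d : set (d.-tuple R) -> \bar R :=
  match d with
  | 0 => \d_([tuple] : 0.-tuple R)
  | d'.+1 =>
      pushforward (@lebesgue_tuple d' \x lebesgue_measure)%E (@conspt d')
  end.

Lemma lebesgue_tuple_is_measure d :
  exists m : {sigma_finite_measure set (d.-tuple R) -> \bar R},
    @lebesgue_tuple d = m.
Proof.
elim: d => [|d [m mE]].
  by exists (dirac ([tuple] : 0.-tuple R)).
rewrite /= mE.
have mf := @measurable_conspt d.
unshelve epose (p := [the {measure set (d.+1.-tuple R) -> \bar R} of
  pushforward (m \x lebesgue_measure)%E (@conspt d)]) => //.
have sf : sigma_finite setT p.
  have [F FT mF] : sigma_finite setT (m \x @lebesgue_measure R)%E.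
    exact: sigma_finite_product.
  pose g (x : d.+1.-tuple R) : d.-tuple R * measurableTypeR R :=
    ([tuple of behead x], thead x).
  have mg : measurable_fun setT g.
    apply: (@measurable_fun_pair _ _ _ _ _ (measurableTypeR R)) => /=.
      exact: measurable_behead.
    by move=> mT Y mY; exact: (measurable_tnth ord0 mT).
  have gK q : g (conspt q) = q.
    by case: q => a b; rewrite /g theadE; congr pair; exact: val_inj.
  exists (fun n => g @^-1` F n).
    by rewrite -preimage_bigcup -FT preimage_setT.
  move=> n; have [mFn Fn] := mF n; split.
    by rewrite -[X in measurable X]setTI; exact: mg.
  rewrite [X in (X < _)%E](_ : _ = (m \x @lebesgue_measure R)%E (F n))//.
  rewrite /p /= /pushforward; congr (_ _).
  by apply/seteqP; split => q /=; rewrite gK.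
pose q := HB.pack_for {sigma_finite_measure set (d.+1.-tuple R) -> \bar R}
  (p : set _ -> \bar R) (Measure.on p) (Measure_isSigmaFinite.Build _ _ _ p sf).
by exists q.
Qed.


Let lebesgue_tuple0 d : @lebesgue_tuple d set0 = 0%E.
Proof. by have [m ->] := lebesgue_tuple_is_measure d; exact: measure0. Qed.

Let lebesgue_tuple_ge0 d A : (0 <= @lebesgue_tuple d A)%E.
Proof. by have [m ->] := lebesgue_tuple_is_measure d; exact: measure_ge0. Qed.

Let lebesgue_tuple_sigma_additive d : semi_sigma_additive (@lebesgue_tuple d).
Proof.
have [m ->] := lebesgue_tuple_is_measure d.
exact: measure_semi_sigma_additive.
Qed.

HB.instance Definition _ d := isMeasure.Build _ _ _ (@lebesgue_tuple d)
  (lebesgue_tuple0 d) (@lebesgue_tuple_ge0 d) (@lebesgue_tuple_sigma_additive d).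

Let lebesgue_tuple_sigma_finite d : sigma_finite setT (@lebesgue_tuple d).
Proof. by have [m ->] := lebesgue_tuple_is_measure d; exact: sigma_finiteT. Qed.

HB.instance Definition _ d := Measure_isSigmaFinite.Build _ _ _
  (@lebesgue_tuple d) (@lebesgue_tuple_sigma_finite d).

Lemma lebesgue_tuple_box d (a b : d.-tuple R) :
    (forall i, tnth a i <= tnth b i) ->
  lebesgue_tuple [set x | forall i, tnth a i <= tnth x i <= tnth b i] =
  (\prod_(i < d) (tnth b i - tnth a i))%:E.
Proof.
elim: d a b => [|d IH] a b ab.
  rewrite /= big_ord0 diracE (_ : _ \in _) // inE /= => -[].
  by [].
rewrite big_ord_recl EFinM /= /pushforward.
pose a' := [tuple of behead a]; pose b' := [tuple of behead b].
have tb (c : d.+1.-tuple R) i : tnth [tuple of behead c] i = tnth c (lift ord0 i).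
  by rewrite [in RHS](tuple_eta c) tnthS.
rewrite (_ : _ @^-1` _ = [set x | forall i, tnth a' i <= tnth x i <= tnth b' i]
   `*` `[tnth a ord0, tnth b ord0]); last first.
  apply/seteqP; split => [[x y] /= h|[x y] /= [h h0] i].
    split.
      by move=> i; have := h (lift ord0 i); rewrite tnthS -!tb.
    by have := h ord0; rewrite in_itv.
  have [->|[j ->]] : i = ord0 \/ exists j, i = lift ord0 j.
  - by case: (unliftP ord0 i) => [j ->|->]; [right; exists j|left].
  - by move: h0; rewrite in_itv.
  - by rewrite tnthS -!tb.
rewrite product_measure1E //; last first.
  rewrite (_ : [set _ | _] = \big[setI/setT]_(i < d)
     ((fun x : d.-tuple R => tnth x i) @^-1` `[tnth a' i, tnth b' i])).
    apply: bigsetI_measurable => i _.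
    by rewrite -[X in measurable X]setTI; exact: measurable_tnth.
  rewrite -bigcap_seq /=; apply/seteqP; split => x /= h i.
    by move=> _ /=; rewrite in_itv /=; exact: h.
  by have := h i; rewrite /= in_itv /= mem_index_enum; exact.
rewrite [X in (X * _)%E]IH; last by move=> i; rewrite !tb.
rewrite [X in (_ * X)%E]lebesgue_measure_itv /= lte_fin.
rewrite (_ : (if _ then _ else _) = (tnth b ord0 - tnth a ord0)%:E); last first.
  case: ltgtP (ab ord0) => [||->]// _; by rewrite subrr.
by rewrite muleC; congr (_ * _%:E)%E; apply: eq_bigr => i _; rewrite !tb.
Qed.

End euclidean.

Section borel.
Context {R : realType}.
Variable d : nat.

Let rV_of (x : d.-tuple R) : 'rV[R]_d := \row_i tnth x i.
Let tuple_of_rV (v : 'rV[R]_d) : d.-tuple R := [tuple v ord0 i | i < d].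

(* The product sigma-algebra on [d.-tuple R] is the Borel one: it corresponds
   to the sigma-algebra generated by the open sets of ['rV[R]_d]. *)
Lemma measurable_tuple_borel (A : set (d.-tuple R)) :
  measurable A <->
  <<s [set U : set 'rV[R]_d | open U] >> [set v | A [tuple v ord0 i | i < d]].
Proof.
pose O := [set U : set 'rV[R]_d | open U].
have openP U : open U -> measurable (U : set (g_sigma_algebraType O)).
  exact: sub_sigma_algebra.
split=> [mA|].
  have mt : measurable_fun (setT : set (g_sigma_algebraType O)) tuple_of_rV.
    apply/measurable_fun_tnthP => i.
    rewrite (_ : _ \o _ = (fun v : g_sigma_algebraType O => v ord0 i)); last first.
      by apply/funext => v /=; rewrite tnth_mktuple.
    apply: (measurability _ (RGenOpens.measurableE R)) => _ [_ [a [b ->]] <-].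
    rewrite setTI; apply: openP.
    have /continuousP := @coord_continuous R 1 d ord0 i.
    by apply; exact: interval_open.
  by have := mt measurableT _ mA; rewrite setTI.
move=> mA.
have mr : measurable_fun setT (rV_of : _ -> g_sigma_algebraType O).
  apply: (@measurability _ _ _ (g_sigma_algebraType O) setT rV_of O erefl).
  move=> _ [U oU <-]; rewrite setTI.
  pose box (p : d.-tuple rat * nat) : set (d.-tuple R) :=
    \big[setI/setT]_(i < d)
      [set x | ball (ratr (tnth p.1 i) : R) p.2.+1%:R^-1 (tnth x i)].
  have boxE p x : box p x <->
      forall i, ball (ratr (tnth p.1 i) : R) p.2.+1%:R^-1 (tnth x i).
    rewrite /box -bigcap_seq /=; split=> [h i|h i _]; last exact: h.
    by apply: h => /=; rewrite mem_index_enum.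
  have mbox p : measurable (box p).
    apply: bigsetI_measurable => i _.
    rewrite -[X in measurable X]setTI; apply: (measurable_tnth i) => //.
    by rewrite ball_itv; exact: measurable_itv.
  pose C := [set p | box p `<=` rV_of @^-1` U].
  rewrite (_ : _ @^-1` _ = \bigcup_(p in C) box p); last first.
    apply/seteqP; split => [x Ux|x [p Cp]]; last exact: Cp.
    have /nbhs_ballP[e e0 eU] : nbhs (rV_of x) U by exact: open_nbhs_nbhs.
    have e20 : 0 < e / 2 by rewrite divr_gt0.
    have [n _ /(_ n (leqnn n)) ne] := near_infty_natSinv_lt (PosNum e20).
    have n0 : 0 < n.+1%:R^-1 :> R by rewrite invr_gt0.
    have ratx i : exists q : rat, ball (ratr q : R) n.+1%:R^-1 (tnth x i).
      have lt : tnth x i - n.+1%:R^-1 < tnth x i + n.+1%:R^-1.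
        by rewrite ltrD2l gtrN.
      have [q] := rat_in_itvoo lt; rewrite in_itv /= => qx.
      by exists q; rewrite /ball /= ltr_distl.
    pose q := [tuple projT1 (cid (ratx i)) | i < d].
    have qx i : ball (ratr (tnth q i) : R) n.+1%:R^-1 (tnth x i).
      by rewrite tnth_mktuple; case: cid.
    exists (q, n); last exact/boxE.
    move=> y /boxE qy; apply: eU; split => // i j; rewrite !mxE.
    apply: (@le_ball _ _ _ (n.+1%:R^-1 + n.+1%:R^-1)).
      by rewrite (splitr e) lerD// ltW.
    by apply: ball_triangle (qy j); apply: ball_sym.
  rewrite bigcup_mkcond; apply: countable_bigcupT_measurable => // p.
  by case: ifP.
have := mr measurableT _ mA; rewrite setTI.
rewrite (_ : _ @^-1` _ = A)//; apply/funext => x /=; congr A.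
by apply: eq_from_tnth => i; rewrite tnth_mktuple mxE.
Qed.

End borel.

Section fourier_spectrum.
Context {R : realType} {d : nat}.
Implicit Types (mu nu : {finite_measure set (d.-tuple R) -> \bar R})
  (s theta : R) (z : d.-tuple R).

Definition convolution mu nu : set (d.-tuple R) -> \bar R :=
  pushforward (mu \x nu)%E (@addpt R d).

Let convolution0 mu nu : convolution mu nu set0 = 0%E.
Proof. by rewrite /convolution /pushforward preimage_set0 measure0. Qed.

Let convolution_ge0 mu nu A : (0 <= convolution mu nu A)%E.
Proof. by apply: integral_ge0 => x _; exact: measure_ge0. Qed.

Let convolution_sigma_additive mu nu :
  semi_sigma_additive (convolution mu nu).
Proof.
have mf := @measurable_addpt R d.
unshelve epose (p := [the {measure set (d.-tuple R) -> \bar R} of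
  pushforward (mu \x nu)%E (@addpt R d)]) => //.
exact: (@measure_semi_sigma_additive _ _ _ p).
Qed.

HB.instance Definition _ mu nu := isMeasure.Build _ _ _ (convolution mu nu)
  (convolution0 mu nu) (@convolution_ge0 mu nu)
  (@convolution_sigma_additive mu nu).

Let convolution_fin mu nu : fin_num_fun (convolution mu nu).
Proof.
suff h : ((mu \x nu) [set: d.-tuple R * d.-tuple R] < +oo)%E.
  exact: lty_fin_num_fun.
rewrite -setXTT [X in (X < _)%E]product_measure1E//.
by rewrite lte_mul_pinfty// ?fin_num_measure// ltey_eq fin_num_measure.
Qed.

HB.instance Definition _ mu nu := Measure_isFinite.Build _ _ _
  (convolution mu nu) (@convolution_fin mu nu).

(* exp (i * phi) with phi = - 2 pi z.x is cos phi + i sin phi, and a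
   complex-valued integral is computed on real and imaginary parts. *)
Definition fourier_transform mu z : R[i] :=
  ((\int[mu]_x cos (- (2 * pi * dotpr z x))) +i*
   (\int[mu]_x sin (- (2 * pi * dotpr z x))))%C.

Definition energy s theta mu : \bar R :=
  ((\int[@lebesgue_tuple R d]_z
     (Normc.normc (fourier_transform mu z) `^ (2 / theta) *
      enorm z `^ (s / theta - d%:R))%:E) `^ theta)%E.

(* [maxe 0] implements the convention sup set0 = 0 (the library has
   ereal_sup set0 = -oo); it does not change the supremum otherwise. *)
Definition fourier_spectrum theta mu : \bar R :=
  maxe 0%E (ereal_sup
    [set s%:E | s in [set s : R | 0 <= s /\ (energy s theta mu < +oo)%E]]).

Definition sobolev_dim mu : \bar R := fourier_spectrum 1 mu.

End fourier_spectrum.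

(* Main.v *)
(* Let t = dim_S nu. The hypothesis gives theta in (0,1) and u > t theta with
   J_{u,theta}(mu) finite. For b < t close to t, the exponent
   s' = u + b (1 - theta) exceeds t, and Young's inequality with exponents
   1/theta and 1/(1 - theta) bounds the energy integrand of mu * nu by
     |mu^|^(2/theta) |z|^(u/theta - d) + |nu^|^(2/(1 - theta)) |z|^(b - d).
   The second term is O(|nu^|^2 |z|^(b - d)) as nu^ is bounded; it is only
   integrated over |z| > 1, because b may be negative when t = 0. On |z| <= 1
   the energy converges because the transforms are bounded and s' > 0. *)
Require Import Defs.
From mathcomp Require Import all_boot all_order all_algebra.
From mathcomp Require Import all_classical all_reals all_analysis.
From mathcomp Require Import complex ring lra measurable_realfun.

Set Implicit Arguments.
Unset Strict Implicit.
Unset Printing Implicit Defensive.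
Import Order.TTheory GRing.Theory Num.Theory.
Import numFieldNormedType.Exports.
Local Open Scope classical_set_scope.
Local Open Scope ring_scope.

(** * Bounded functions on finite measure spaces and Fubini's theorem *)

Lemma bounded_integrable (R : realType) (disp : measure_display)
    (T : measurableType disp) (m : {finite_measure set T -> \bar R})
    (f : T -> R) (C : R) :
  measurable_fun setT f -> (forall x, `|f x| <= C) ->
  m.-integrable setT (EFin \o f).
Proof.
move=> mf fC; apply: measurable_bounded_integrable => //.
  by rewrite ltey_eq fin_num_measure.
exists C; split; first exact: num_real.
by move=> y Cy x _; apply: le_trans (fC x) _; exact: ltW.
Qed.

Lemma normr_Rintegral_le (R : realType) (disp : measure_display)
    (T : measurableType disp) (m : {finite_measure set T -> \bar R})
    (f : T -> R) :
  measurable_fun setT f -> (forall x, `|f x| <= 1) ->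
  `|\int[m]_x f x| <= fine (m setT).
Proof.
move=> mf f1; have fi := @bounded_integrable _ _ _ m _ _ mf f1.
apply: le_trans (le_normr_Rintegral measurableT fi) _.
apply: (@le_trans _ _ (\int[m]_x cst 1 x)).
  apply: le_Rintegral => //.
    apply: (@bounded_integrable _ _ _ _ _ 1) => [|x]; last by rewrite normr_id.
    exact: measurableT_comp.
  by apply: (@bounded_integrable _ _ _ _ _ 1) => // x; rewrite normr1.
by rewrite Rintegral_cst// mul1r.
Qed.

Lemma product_measure_lty (R : realType) (d1 d2 : measure_display)
    (T1 : measurableType d1) (T2 : measurableType d2)
    (m1 : {finite_measure set T1 -> \bar R})
    (m2 : {finite_measure set T2 -> \bar R}) :
  ((m1 \x m2) setT < +oo)%E.
Proof.
rewrite -setXTT [X in (X < _)%E]product_measure1E//.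
by rewrite lte_mul_pinfty// ?fin_num_measure// ltey_eq fin_num_measure.
Qed.

(** By Fubini the factor [f x] leaves the inner integral, and then the constant [\int[m2]_y g y]
    leaves the outer one. Integrability is part of the conclusion because splitting the integrals of
    $\cos(a+b)$ and $\sin(a+b)$ over the product requires it. *)
Lemma Rintegral_prodM (R : realType) (d1 d2 : measure_display)
    (T1 : measurableType d1) (T2 : measurableType d2)
    (m1 : {finite_measure set T1 -> \bar R})
    (m2 : {finite_measure set T2 -> \bar R}) (f : T1 -> R) (g : T2 -> R) :
  measurable_fun setT f -> measurable_fun setT g ->
  (forall x, `|f x| <= 1) -> (forall x, `|g x| <= 1) ->
  (m1 \x m2)%E.-integrable setT (fun p => (f p.1 * g p.2)%:E) /\
  \int[(m1 \x m2)%E]_p (f p.1 * g p.2) = (\int[m1]_x f x) * (\int[m2]_x g x).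
Proof.
move=> mf mg f1 g1.
have fi := @bounded_integrable _ _ _ m1 _ _ mf f1.
have gi := @bounded_integrable _ _ _ m2 _ _ mg g1.
have mfg : measurable_fun setT (fun p : T1 * T2 => f p.1 * g p.2).
  by apply: measurable_funM; [apply: measurableT_comp|apply: measurableT_comp].
have fgi : (m1 \x m2)%E.-integrable setT (fun p => (f p.1 * g p.2)%:E).
  apply: measurable_bounded_integrable => //; first exact: product_measure_lty.
  exists 1; split; first exact: num_real.
  move=> y y1 x _; apply: le_trans (ltW y1).
  by rewrite normrM mulr_ile1.
split=> //.
rewrite /Rintegral -integral12_prod_meas1//= /fubini_F.
have gE : (\int[m2]_y (g y)%:E)%E = (\int[m2]_y g y)%:E.
  by rewrite /Rintegral fineK//; exact: integrable_fin_num.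
have -> : (\int[m1]_x \int[m2]_y (f x * g y)%:E =
          \int[m1]_x ((\int[m2]_y g y)%:E * (f x)%:E))%E.
  apply: eq_integral => x _.
  under eq_integral do rewrite EFinM.
  by rewrite integralZl//= gE muleC.
rewrite integralZl//= fineM//=; first by rewrite mulrC.
exact: integrable_fin_num.
Qed.

(** * Modulus of the Fourier transform: measurability, bound, convolution *)

Section fourier.
Context {R : realType} {d : nat}.
Implicit Types mu nu : {finite_measure set (d.-tuple R) -> \bar R}.

Lemma measurable_dotpr :
  measurable_fun setT (fun p : d.-tuple R * d.-tuple R => dotpr p.1 p.2).
Proof.
rewrite /dotpr; apply: measurable_sum => i; apply: measurable_funM.
  exact: (measurableT_comp (measurable_tnth i)).
exact: (measurableT_comp (measurable_tnth i)).
Qed.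

Lemma measurable_Rsqrt : measurable_fun setT (@Num.sqrt R).
Proof. apply: continuous_measurable_fun; exact: sqrt_continuous. Qed.

Lemma measurable_enorm : measurable_fun setT (@enorm R d).
Proof.
apply: (measurableT_comp measurable_Rsqrt).
by rewrite /dotpr; apply: measurable_sum => i; apply: measurable_funM; exact: measurable_tnth.
Qed.

Definition phase (z x : d.-tuple R) : R := - (2 * pi * dotpr z x).

Lemma measurable_phase2 :
  measurable_fun setT (fun p : d.-tuple R * d.-tuple R => phase p.1 p.2).
Proof.
apply: measurableT_comp => //; apply: measurable_funM => //.
exact: measurable_dotpr.
Qed.

Lemma measurable_phase z : measurable_fun setT (phase z).
Proof. exact: (measurableT_comp measurable_phase2 (measurable_pair1 z)). Qed.

Lemma measurable_cos : measurable_fun setT (@cos R).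
Proof. apply: continuous_measurable_fun; exact: continuous_cos. Qed.

Lemma measurable_sin : measurable_fun setT (@sin R).
Proof. apply: continuous_measurable_fun; exact: continuous_sin. Qed.

Lemma normr_cos_le1 (x : R) : `|cos x| <= 1.
Proof. by rewrite ler_norml cos_geN1 cos_le1. Qed.

Lemma normr_sin_le1 (x : R) : `|sin x| <= 1.
Proof. by rewrite ler_norml sin_geN1 sin_le1. Qed.

Lemma measurable_phase_integral mu (g : R -> R) :
  measurable_fun setT g -> (forall x, `|g x| <= 1) ->
  measurable_fun setT (fun z => \int[mu]_x g (phase z x)).
Proof.
move=> mg g1.
(* Tonelli applies to [g + 1], which is nonnegative *)
have gE z : \int[mu]_x g (phase z x) =
    \int[mu]_x (g (phase z x) + 1) - fine (mu setT).
  have mgz : measurable_fun setT (fun x => g (phase z x)).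
    exact: (measurableT_comp mg (measurable_phase z)).
  rewrite RintegralD//; last 2 first.
  - by apply: (@bounded_integrable _ _ _ _ _ 1).
  - by apply: (@bounded_integrable _ _ _ _ (cst 1) 1) => // x; rewrite normr1.
  by rewrite Rintegral_cst// mul1r addrK.
under eq_fun do rewrite gE.
apply: measurable_funB => //.
apply: (measurableT_comp (@fine_measurable R _ measurableT)).
apply: (@measurable_fun_fubini_tonelli_F _ _ _ _ _ mu
  (fun p : d.-tuple R * d.-tuple R => (g (phase p.1 p.2) + 1)%:E)).
  apply/measurable_EFinP; apply: measurable_funD => //.
  exact: (measurableT_comp mg measurable_phase2).
by move=> p; rewrite lee_fin; have := g1 (phase p.1 p.2); rewrite ler_norml; lra.
Qed.

Definition fourier_norm mu (z : d.-tuple R) : R :=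
  Normc.normc (fourier_transform mu z).

Lemma fourier_normE mu z : fourier_norm mu z =
  Num.sqrt ((\int[mu]_x cos (phase z x)) ^+ 2 +
            (\int[mu]_x sin (phase z x)) ^+ 2).
Proof. by []. Qed.

Lemma fourier_norm_ge0 mu z : 0 <= fourier_norm mu z.
Proof. by rewrite fourier_normE sqrtr_ge0. Qed.

Lemma measurable_fourier_norm mu : measurable_fun setT (fourier_norm mu).
Proof.
apply: (measurableT_comp measurable_Rsqrt).
apply: measurable_funD; apply: measurable_funX.
  exact: (measurable_phase_integral mu measurable_cos normr_cos_le1).
exact: (measurable_phase_integral mu measurable_sin normr_sin_le1).
Qed.

(** The real and imaginary parts are each at most the total mass $m$ in absolute value, so the
    modulus is at most $\sqrt2\,m$. The constant 2 is a convenient weakening: only boundedness in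
    $z$ is used later. *)
Lemma fourier_norm_le mu z : fourier_norm mu z <= 2 * fine (mu setT).
Proof.
have m0 : 0 <= fine (mu setT) by rewrite fine_ge0.
have mc : measurable_fun setT (fun x => cos (phase z x)).
  exact: (measurableT_comp measurable_cos (measurable_phase z)).
have ms : measurable_fun setT (fun x => sin (phase z x)).
  exact: (measurableT_comp measurable_sin (measurable_phase z)).
have := normr_Rintegral_le mu mc (fun x => normr_cos_le1 _).
have := normr_Rintegral_le mu ms (fun x => normr_sin_le1 _).
rewrite fourier_normE.
move: (\int[mu]_x cos _) (\int[mu]_x sin _) => a b.
move: (fine _) m0 => m m0 /ler_normlP[b1 b2] /ler_normlP[a1 a2].
rewrite -[leRHS]ger0_norm ?mulr_ge0// -sqrtr_sqr.
by rewrite ler_sqrt ?sqr_ge0//; nra.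
Qed.

Lemma phase_add z (p : d.-tuple R * d.-tuple R) :
  phase z (addpt p) = phase z p.1 + phase z p.2.
Proof.
rewrite /phase -opprD -mulrDr; congr (- (_ * _)).
rewrite /dotpr -big_split /=; apply: eq_bigr => i _.
by rewrite tnth_mktuple mulrDr.
Qed.

Lemma Rintegral_convolution mu nu (g : d.-tuple R -> R) :
  measurable_fun setT g -> (forall x, `|g x| <= 1) ->
  \int[convolution mu nu]_x g x = \int[(mu \x nu)%E]_p g (addpt p).
Proof.
move=> mg g1.
rewrite /Rintegral; congr fine.
have := @integral_pushforward _ _ _ _ _ _ (@measurable_addpt R d) (mu \x nu)%E
  setT (EFin \o g).
rewrite preimage_setT; apply => //; first exact/measurable_EFinP.
apply: measurable_bounded_integrable => //.
- exact: product_measure_lty.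
- exact: (measurableT_comp mg (@measurable_addpt R d)).
- exists 1; split; first exact: num_real.
  by move=> y y1 x _; exact: le_trans (g1 _) (ltW y1).
Qed.

(** The convolution theorem for moduli. The integral over the convolution is an integral over the
    product measure, where the addition formulas split cosine and sine into products of a function
    of each variable. *)
Lemma fourier_norm_convolution mu nu z :
  fourier_norm (convolution mu nu) z = fourier_norm mu z * fourier_norm nu z.
Proof.
have mc : measurable_fun setT (fun x => cos (phase z x)).
  exact: (measurableT_comp measurable_cos (measurable_phase z)).
have ms : measurable_fun setT (fun x => sin (phase z x)).
  exact: (measurableT_comp measurable_sin (measurable_phase z)).
have c1 x : `|cos (phase z x)| <= 1 by exact: normr_cos_le1.
have s1 x : `|sin (phase z x)| <= 1 by exact: normr_sin_le1.
have [icc cc] := Rintegral_prodM mu nu mc mc c1 c1.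
have [iss ss] := Rintegral_prodM mu nu ms ms s1 s1.
have [ics cs] := Rintegral_prodM mu nu mc ms c1 s1.
have [isc sc] := Rintegral_prodM mu nu ms mc s1 c1.
rewrite !fourier_normE -sqrtrM ?addr_ge0 ?sqr_ge0//; congr Num.sqrt.
rewrite (Rintegral_convolution _ _ mc c1) (Rintegral_convolution _ _ ms s1).
under eq_Rintegral do rewrite phase_add cosD.
under [X in _ + X ^+ 2]eq_Rintegral do rewrite phase_add sinD.
rewrite RintegralB// RintegralD// cc ss cs sc.
(* This is $(ac-bd)^2+(bc+ad)^2=(a^2+b^2)(c^2+d^2)$, the multiplicativity of the complex modulus. *)
ring.
Qed.

End fourier.

(** * Geometric series and dyadic shells *)

Lemma geometric_nneseries_lty (R : realType) (a q : R) :
  0 <= q < 1 -> (\sum_(0 <= k <oo) (a * q ^+ k)%:E < +oo)%E.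
Proof.
move=> /andP[q0 q1].
have q1' : `|q| < 1 by rewrite ger0_norm.
suff -> : (\sum_(0 <= k <oo) (a * q ^+ k)%:E = (a / (1 - q))%:E)%E by rewrite ltry.
apply: cvg_lim => //.
under eq_fun do rewrite sumEFin.
by apply: cvg_EFin; [exact: nearW|exact: cvg_geometric_series].
Qed.

Lemma dyadic_shell (R : realType) (y : R) : 1 <= y ->
  exists k, 2 ^+ k <= y <= 2 ^+ k.+1.
Proof.
move=> y1; have y0 : 0 <= y by rewrite (le_trans _ y1).
have /andP[ny yn] := truncn_itv y0.
have n0 : (0 < Num.truncn y)%N.
  by rewrite lt0n; apply/eqP => n0; move: yn; rewrite n0 ltNge y1.
(* For $n=\lfloor y\rfloor$ this is the $k$ with $2^k\le n<2^{k+1}$. As these are integers, $n+1\le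
   2^{k+1}$, which bounds $y<n+1$. *)
exists (trunc_log 2 (Num.truncn y)).
have /andP[kn nk] := trunc_log_bounds (isT : (1 < 2)%N) n0.
apply/andP; split.
  by apply: le_trans ny; rewrite -natrX ler_nat.
by apply: (le_trans (ltW yn)); rewrite -natrX ler_nat.
Qed.

(** Since $|\ln(x/m)|\le\ln 2$, one has $(x/m)^p\le 2^{|p|}$ whatever the sign of $p$. *)
Lemma powR_shell_le (R : realType) (x m p : R) :
  0 < m -> m / 2 <= x <= 2 * m -> x `^ p <= 2 `^ `|p| * m `^ p.
Proof.
move=> m0 /andP[mx xm].
have x0 : 0 < x by rewrite (lt_le_trans _ mx)// divr_gt0.
have y0 : 0 < x / m by rewrite divr_gt0.
rewrite -[x in x `^ p](divfK (lt0r_neq0 m0)) powRM ?(ltW y0) ?(ltW m0)//.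
rewrite ler_wpM2r ?powR_ge0//.
rewrite /powR !gt_eqF// ler_expR (le_trans (ler_norm _))// normrM.
rewrite ler_wpM2l// ler_norml.
have l2 : ln (x / m) <= ln 2 :> R.
  by rewrite ler_ln ?posrE// ler_pdivrMr.
rewrite l2 andbT -lnV ?posrE// ler_ln ?posrE ?invr_gt0// ler_pdivlMr//.
by rewrite mulrC.
Qed.

(** * Integrals of powers of the norm inside and outside the unit ball *)

Section radial.
Context {R : realType} {d : nat}.
Local Notation leb := (@lebesgue_tuple R d).
Implicit Types (z : d.-tuple R) (r c : R).

(** Cubes stand in for balls in the shell estimates, because [lebesgue_tuple_box] gives their volume
    exactly. *)
Definition cube r : set (d.-tuple R) := [set x | forall i, - r <= tnth x i <= r].

Lemma measurable_cube r : measurable (cube r).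
Proof.
rewrite (_ : cube r = \big[setI/setT]_(i < d)
    ((fun x : d.-tuple R => tnth x i) @^-1` `[- r, r])).
  apply: bigsetI_measurable => i _.
  by rewrite -[X in measurable X]setTI; exact: measurable_tnth.
rewrite -bigcap_seq /=; apply/seteqP; split => x /= h i.
  by move=> _ /=; rewrite in_itv /=; exact: h.
by have := h i; rewrite /= in_itv /= mem_index_enum; exact.
Qed.

Lemma lebesgue_cube r : 0 <= r -> leb (cube r) = ((2 * r) ^+ d)%:E.
Proof.
move=> r0.
have := @lebesgue_tuple_box R d [tuple - r | i < d] [tuple r | i < d].
rewrite (_ : [set x | _] = cube r); last first.
  by apply/seteqP; split=> x /= h i; have := h i; rewrite !tnth_mktuple.
move=> ->; last by move=> i; rewrite !tnth_mktuple; lra.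
under eq_bigr do rewrite !tnth_mktuple.
by rewrite prodr_const card_ord; congr (_ ^+ _)%:E; ring.
Qed.

Lemma enorm_ge0 z : 0 <= enorm z. Proof. exact: sqrtr_ge0. Qed.

Lemma cube_enorm z r : enorm z <= r -> cube r z.
Proof.
move=> zr i; rewrite -ler_norml (le_trans _ zr)//.
rewrite -sqrtr_sqr /enorm ler_sqrt; last first.
  by apply: sumr_ge0 => j _; rewrite -expr2 sqr_ge0.
rewrite /dotpr (bigD1 i)//= -expr2 lerDl.
by apply: sumr_ge0 => j _; rewrite -expr2 sqr_ge0.
Qed.

Lemma measurable_enorm_powR (D : set (d.-tuple R)) (p : R) :
  measurable_fun D (fun z => enorm z `^ p).
Proof.
apply: measurable_funTS.
exact: (measurableT_comp (measurable_powR p) measurable_enorm).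
Qed.

(* The integral over the [k]-th shell is at most a constant times
   [(rho ^ k) ^ (c - d) * (rho ^ k) ^ d = (rho ^ c) ^ k]. *)
Lemma radial_integral_lty (rho c : R) (D : set (d.-tuple R)) :
  measurable D -> 0 < rho -> rho `^ c < 1 ->
  (forall z, D z -> enorm z = 0 \/
     exists k, rho ^+ k / 2 <= enorm z <= 2 * rho ^+ k) ->
  (\int[leb]_(z in D) (enorm z `^ (c - d%:R))%:E < +oo)%E.
Proof.
move=> mD rho0 rhoc shell.
set p := c - d%:R; pose K : R := 2 `^ `|p|.
have rk0 k : 0 < rho ^+ k by rewrite exprn_gt0.
pose a k : R := K * (rho ^+ k) `^ p.
have a0 k : 0 <= a k by rewrite mulr_ge0 ?powR_ge0.
(* Each [u k] is constant on a cube containing the whole [k]-th shell. The cubes overlap, which is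
   harmless for an upper bound by the sum over [k]. *)
pose u k z : \bar R := ((a k)%:E * (\1_(cube (2 * rho ^+ k)) z)%:E)%E.
have u0 k z : (0 <= u k z)%E by rewrite mule_ge0 ?lee_fin.
have mc k : measurable (cube (2 * rho ^+ k)) := measurable_cube _.
have mi k : measurable_fun D (fun z => (\1_(cube (2 * rho ^+ k)) z)%:E : \bar R).
  by apply/measurable_EFinP; exact: measurable_indic.
have mu k : measurable_fun D (u k).
  by apply: emeasurable_funM => //; exact: measurable_cst.
apply: (@le_lt_trans _ _ (\int[leb]_(z in D) \sum_(0 <= k <oo) u k z)%E).
  apply: ge0_le_integral => //.
  - by move=> z _; rewrite lee_fin powR_ge0.
  - by apply/measurable_EFinP; exact: measurable_enorm_powR.
  - by apply: ge0_emeasurable_sum => // k z _ _; exact: u0.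
  - move=> z Dz.
    (* All terms being nonnegative, a single one that dominates the integrand is enough; it occurs
       in the partial sum of the first [k.+1] terms. *)
    suff [k zk] : exists k, ((enorm z `^ p)%:E <= u k z)%E.
      apply: (le_trans zk).
      apply: le_trans (@nneseries_lim_ge R (u ^~ z) xpredT 0 k.+1 _) => //.
      by rewrite big_nat_recr//= leeDr// sume_ge0.
    have [z0|[k zk]] := shell z Dz.
      exists 0%N; rewrite /u z0 /a expr0 powR1 mulr1 indicE mem_set ?mule1.
        rewrite lee_fin /powR eqxx.
        apply: (@le_trans _ _ 1); first by case: eqP.
        by rewrite /K /powR gt_eqF// -[leLHS]expR0 ler_expR mulr_ge0// ln_ge0// ler1n.
      by apply: cube_enorm; rewrite z0 mulr_ge0.
    exists k; rewrite /u indicE mem_set ?mule1; last first.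
      by apply: cube_enorm; case/andP: zk.
    by rewrite lee_fin; exact: powR_shell_le.
rewrite integral_nneseries//.
have q01 : 0 <= rho `^ c < 1 by rewrite powR_ge0.
apply: le_lt_trans (geometric_nneseries_lty (K * 4 ^+ d) q01).
apply: lee_nneseries => [k _ _|k _]; first by apply: integral_ge0 => z _; exact: u0.
rewrite /u ge0_integralZl_EFin// integral_indic//.
apply: (@le_trans _ _ ((a k)%:E * leb (cube (2 * rho ^+ k)))%E).
  by rewrite lee_pmul// ?lee_fin// le_measure ?inE//; exact: measurableI.
rewrite lebesgue_cube ?mulr_ge0 ?(ltW (rk0 _))// -EFinM lee_fin /a.
have -> : (2 * (2 * rho ^+ k)) ^+ d = 4 ^+ d * (rho ^+ k) `^ d%:R.
  by rewrite powR_mulrn ?(ltW (rk0 _))// -exprMn; congr (_ ^+ _); ring.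
have -> : K * (rho ^+ k) `^ p * (4 ^+ d * (rho ^+ k) `^ d%:R) =
    K * 4 ^+ d * ((rho ^+ k) `^ p * (rho ^+ k) `^ d%:R) by ring.
rewrite -powRD; last by rewrite (gt_eqF (rk0 k)) implybT.
rewrite /p subrK -!powR_mulrn ?powR_ge0 ?(ltW rho0)// -powRrM.
by rewrite -powRrM [k%:R * c]mulrC.
Qed.

Lemma measurable_unit_ball : measurable [set z : d.-tuple R | enorm z <= 1].
Proof.
rewrite (_ : mkset _ = setT `&` (@enorm R d) @^-1` `]-oo, 1]); last first.
  by apply/seteqP; split=> z /=; rewrite in_itv /= => // -[].
exact: measurable_enorm.
Qed.

(** The shells have ratio $\rho=1/2$, so that $\rho^c<1$ for $c>0$; the shell of $z\neq0$ is found
    by placing $1/|z|\ge1$ between powers of two. *)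
Lemma near_integral_lty c : 0 < c ->
  (\int[leb]_(z in [set z : d.-tuple R | (enorm z <= 1)%R])
    (enorm z `^ (c - d%:R))%:E < +oo)%E.
Proof.
move=> c0; apply: (@radial_integral_lty 2^-1) => //.
- exact: measurable_unit_ball.
- rewrite /powR gt_eqF// -[ltRHS]expR0 ltr_expR lnV ?posrE// mulrN oppr_lt0.
  by rewrite mulr_gt0// ln_gt0// ltr1n.
move=> z /= z1; have := enorm_ge0 z; rewrite le_eqVlt => /orP[/eqP<-|z0]; first by left.
right; have zV : 1 <= (enorm z)^-1 by rewrite invf_ge1.
have [k /andP[kz zk]] := dyadic_shell zV; exists k; apply/andP; split.
  by rewrite exprVn -invfM -[leRHS]invrK lef_pV2 ?posrE ?invr_gt0// -exprSr.
have h : enorm z <= (2 ^+ k)^-1.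
  by rewrite -[leLHS]invrK lef_pV2 ?posrE ?invr_gt0// exprn_gt0.
apply: (le_trans h); rewrite exprVn ler_peMl ?invr_ge0 ?exprn_ge0//; lra.
Qed.

(** Here the ratio is $\rho=2$, and $2^c<1$ because $c<0$. *)
Lemma far_integral_lty c : c < 0 ->
  (\int[leb]_(z in ~` [set z : d.-tuple R | (enorm z <= 1)%R])
    (enorm z `^ (c - d%:R))%:E < +oo)%E.
Proof.
move=> c0; apply: (@radial_integral_lty 2) => //.
- by apply: measurableC; exact: measurable_unit_ball.
- by rewrite /powR gt_eqF// -[ltRHS]expR0 ltr_expR nmulr_rlt0// ln_gt0// ltr1n.
move=> z /= /negP; rewrite -ltNge => /ltW z1; right.
have [k /andP[kz zk]] := dyadic_shell z1; exists k.
rewrite -exprS zk andbT (le_trans _ kz)// ler_piMr ?exprn_ge0//; lra.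
Qed.

End radial.

(** * Finiteness of energies and the estimate for the convolution *)

Section sobolev.
Context {R : realType} {d : nat}.
Local Notation leb := (@lebesgue_tuple R d).
Local Notation ball1 := [set z : d.-tuple R | (enorm z <= 1)%R].
Implicit Types (mu nu : {finite_measure set (d.-tuple R) -> \bar R})
  (z : d.-tuple R).

Lemma measurable_energy_integrand mu (p c : R) (D : set (d.-tuple R)) :
  measurable_fun D (fun z => (fourier_norm mu z `^ p * enorm z `^ c)%:E).
Proof.
apply/measurable_EFinP; apply: measurable_funM; last exact: measurable_enorm_powR.
apply: measurable_funTS.
exact: (measurableT_comp (measurable_powR p) (measurable_fourier_norm mu)).
Qed.

(** The outer power [theta] is positive, so it does not change whether the value is finite. *)
Lemma energy_lty (s theta : R) mu : 0 < theta ->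
  (energy s theta mu < +oo)%E <->
  (\int[leb]_z (fourier_norm mu z `^ (2 / theta) *
    enorm z `^ (s / theta - d%:R))%:E < +oo)%E.
Proof.
by move=> th0; split => [/(lty_poweRy (lt0r_neq0 th0))|/(poweR_lty theta)].
Qed.

(** As [b] is nonnegative, the inequality cannot come from the value 0 inserted by [maxe], so it
    comes from an element of the set itself. *)
Lemma fourier_spectrum_gt (b theta : R) mu : 0 <= b ->
  (b%:E < fourier_spectrum theta mu)%E ->
  exists2 u, b < u & (energy u theta mu < +oo)%E.
Proof.
move=> b0; rewrite /fourier_spectrum lt_max => /orP[|].
  by rewrite lte_fin ltNge b0.
by move=> /ereal_sup_gt[_ [u [_ uoo] <-]]; rewrite lte_fin => bu; exists u.
Qed.

Lemma fourier_norm_powR_le mu (p : R) z : 0 <= p ->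
  fourier_norm mu z `^ p <= (2 * fine (mu setT)) `^ p.
Proof.
move=> p0; rewrite ge0_ler_powR ?nnegrE ?fourier_norm_ge0 ?fourier_norm_le//.
by rewrite mulr_ge0// fine_ge0.
Qed.

Lemma bounded_integral_lty mu (p c : R) (D : set (d.-tuple R)) :
  measurable D -> 0 <= p ->
  (\int[leb]_(z in D) (enorm z `^ c)%:E < +oo)%E ->
  (\int[leb]_(z in D) (fourier_norm mu z `^ p * enorm z `^ c)%:E < +oo)%E.
Proof.
move=> mD p0 Doo; set M := (2 * fine (mu setT)) `^ p.
apply: (@le_lt_trans _ _ (\int[leb]_(z in D) (M%:E * (enorm z `^ c)%:E))%E).
  apply: ge0_le_integral => //.
  - by move=> z _; rewrite lee_fin mulr_ge0 ?powR_ge0.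
  - exact: measurable_energy_integrand.
  - apply: emeasurable_funM; first exact: measurable_cst.
    by apply/measurable_EFinP; exact: measurable_enorm_powR.
  - by move=> z _; rewrite lee_fin ler_wpM2r ?powR_ge0// fourier_norm_powR_le.
rewrite ge0_integralZl_EFin ?powR_ge0//.
- by rewrite lte_mul_pinfty// lee_fin powR_ge0.
- by move=> z _; rewrite lee_fin powR_ge0.
- by apply/measurable_EFinP; exact: measurable_enorm_powR.
Qed.

(* Only the tail of the energy is monotone in [b], and for [b < 0], where no
   Sobolev energy need be finite, it converges because the transform is
   bounded. *)
Lemma sobolev_tail_lty (b : R) nu : (b%:E < sobolev_dim nu)%E ->
  (\int[leb]_(z in ~` ball1)
    (fourier_norm nu z `^ 2 * enorm z `^ (b - d%:R))%:E < +oo)%E.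
Proof.
move=> bnu.
have mB : measurable (~` ball1) by apply: measurableC; exact: measurable_unit_ball.
have [b0|b0] := ltP b 0.
  by apply: bounded_integral_lty => //; exact: far_integral_lty.
have [u bu /energy_lty] := fourier_spectrum_gt b0 bnu.
rewrite !divr1 => /(_ ltr01) uoo; apply: le_lt_trans uoo.
apply: (@le_trans _ _ (\int[leb]_(z in ~` ball1)
    (fourier_norm nu z `^ 2 * enorm z `^ (u - d%:R))%:E)%E).
  apply: ge0_le_integral => //.
  - by move=> z _; rewrite lee_fin mulr_ge0 ?powR_ge0.
  - exact: measurable_energy_integrand.
  - exact: measurable_energy_integrand.
  - move=> z /= /negP; rewrite -ltNge => /ltW z1.
    by rewrite lee_fin ler_wpM2l ?powR_ge0// ler_powR// lerB// ltW.
apply: ge0_subset_integral => //.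
- exact: measurable_energy_integrand.
- by move=> z _; rewrite lee_fin mulr_ge0 ?powR_ge0.
Qed.

Lemma young_powR (theta u b m n y : R) : 0 < theta < 1 ->
  0 <= m -> 0 <= n -> 0 < y ->
  (m * n) `^ 2 * y `^ (u + b * (1 - theta) - d%:R) <=
  m `^ (2 / theta) * y `^ (u / theta - d%:R) +
  n `^ (2 / (1 - theta)) * y `^ (b - d%:R).
Proof.
move=> /andP[th0 th1] m0 n0 y0.
have th1' : 0 < 1 - theta by rewrite subr_gt0.
have -> : (m * n) `^ 2 * y `^ (u + b * (1 - theta) - d%:R) =
    (m `^ 2 * y `^ (u - theta * d%:R)) *
    (n `^ 2 * y `^ ((b - d%:R) * (1 - theta))).
  (* The exponent $-d$ is shared out as $-\theta d-(1-\theta)d$, so that raising the two factors to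
     the powers $1/\theta$ and $1/(1-\theta)$ leaves $-d$ in each. *)
  have -> : u + b * (1 - theta) - d%:R =
    u - theta * d%:R + (b - d%:R) * (1 - theta) by ring.
  rewrite powRD; last by rewrite (gt_eqF y0) implybT.
  by rewrite powRM//; ring.
have pq : theta^-1^-1 + (1 - theta)^-1^-1 = 1 by rewrite !invrK; ring.
have A0 : 0 <= m `^ 2 * y `^ (u - theta * d%:R) by rewrite mulr_ge0 ?powR_ge0.
have B0 : 0 <= n `^ 2 * y `^ ((b - d%:R) * (1 - theta)).
  by rewrite mulr_ge0 ?powR_ge0.
have t0 : 0 < theta^-1 by rewrite invr_gt0.
have t1 : 0 < (1 - theta)^-1 by rewrite invr_gt0.
apply: le_trans (conjugate_powR A0 B0 t0 t1 pq) _.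
rewrite !powRM ?powR_ge0// -!powRrM !invrK.
have -> : (u - theta * d%:R) * theta^-1 = u / theta - d%:R.
  by rewrite mulrBl mulrAC divff ?mul1r// gt_eqF.
(* The weights $\theta$ and $1-\theta$ in Young's inequality are at most 1 and are dropped. *)
by rewrite (mulfK (lt0r_neq0 th1')) lerD// ler_piMr ?mulr_ge0 ?powR_ge0//; lra.
Qed.

Lemma energy_convolution_lty mu nu (theta u b : R) : 0 < theta < 1 ->
  (energy u theta mu < +oo)%E -> (b%:E < sobolev_dim nu)%E ->
  0 < u + b * (1 - theta) ->
  (energy (u + b * (1 - theta)) 1 (convolution mu nu) < +oo)%E.
Proof.
move=> th muoo bnu s0; have /andP[th0 th1] := th.
have mB : measurable ball1 by exact: measurable_unit_ball.
have mC : measurable (~` ball1) by exact: measurableC.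
apply/energy_lty => //; rewrite !divr1.
rewrite -(setUv ball1) ge0_integral_setU//; last 3 first.
- exact: measurable_energy_integrand.
- by move=> z _; rewrite lee_fin mulr_ge0 ?powR_ge0.
- by rewrite disj_set2E setICr.
apply: lte_add_pinfty.
  by apply: bounded_integral_lty => //; exact: near_integral_lty.
have q0 : 0 <= 2 / (1 - theta) - 2.
  by rewrite subr_ge0 ler_pdivlMr ?subr_gt0//; lra.
(* The exponent $2/(1-\theta)-2$ is nonnegative, so the bound on $\widehat\nu$ gives
   $|\widehat\nu|^{2/(1-\theta)}\le M|\widehat\nu|^2$, which leaves a Sobolev tail of [nu]. *)
set M := (2 * fine (nu setT)) `^ (2 / (1 - theta) - 2).
have M0 : 0 <= M by exact: powR_ge0.
apply: (@le_lt_trans _ _ (\int[leb]_(z in ~` ball1)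
   ((fourier_norm mu z `^ (2 / theta) * enorm z `^ (u / theta - d%:R))%:E +
    M%:E * (fourier_norm nu z `^ 2 * enorm z `^ (b - d%:R))%:E))%E).
  apply: ge0_le_integral => //.
  - by move=> z _; rewrite lee_fin mulr_ge0 ?powR_ge0.
  - exact: measurable_energy_integrand.
  - apply: emeasurable_funD; first exact: measurable_energy_integrand.
    apply: emeasurable_funM; first exact: measurable_cst.
    exact: measurable_energy_integrand.
  - move=> z /= /negP; rewrite -ltNge => z1.
    rewrite -EFinM -EFinD lee_fin fourier_norm_convolution.
    apply: le_trans (young_powR u b th (fourier_norm_ge0 mu z)
      (fourier_norm_ge0 nu z) (lt_trans ltr01 z1)) _.
    rewrite lerD2l mulrA ler_wpM2r ?powR_ge0//.
    rewrite -[X in _ `^ X <= _](subrK 2) powRD.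
      by rewrite ler_wpM2r ?powR_ge0// fourier_norm_powR_le.
    by rewrite subrK mulf_eq0 invr_eq0 pnatr_eq0 subr_eq0 (gt_eqF th1).
rewrite ge0_integralD//; last 4 first.
- by move=> z _; rewrite lee_fin mulr_ge0 ?powR_ge0.
- exact: measurable_energy_integrand.
- by move=> z _; rewrite lee_fin !mulr_ge0 ?powR_ge0.
- apply: emeasurable_funM; first exact: measurable_cst.
  exact: measurable_energy_integrand.
apply: lte_add_pinfty.
  apply: le_lt_trans (proj1 (energy_lty u mu th0) muoo).
  apply: ge0_subset_integral => //.
  - exact: measurable_energy_integrand.
  - by move=> z _; rewrite lee_fin mulr_ge0 ?powR_ge0.
rewrite ge0_integralZl_EFin//.
- by rewrite lte_mul_pinfty// sobolev_tail_lty.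
- by move=> z _; rewrite lee_fin mulr_ge0 ?powR_ge0.
- exact: measurable_energy_integrand.
Qed.

End sobolev.

(** * Choice of the exponents and conclusion *)

Unset Implicit Arguments.

Theorem corollary6p8 (R : realType) (d : nat) (d_gt0 : (0 < d)%N) (s : R)
    (mu : {finite_measure set (d.-tuple R) -> \bar R}) :
  (s%:E <= ereal_sup [set fourier_spectrum theta mu * theta^-1%:E
                     | theta in [set theta : R | (0 < theta < 1)%R]])%E ->
  forall nu : {finite_measure set (d.-tuple R) -> \bar R},
    (sobolev_dim nu < s%:E)%E ->
    (sobolev_dim nu < sobolev_dim (convolution mu nu))%E.
Proof.
move=> smu nu nus.
have nu0 : (0 <= sobolev_dim nu)%E by rewrite /sobolev_dim /fourier_spectrum le_max lexx.
have nufin : sobolev_dim nu \is a fin_num.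
  by rewrite ge0_fin_numE// (lt_trans nus) ?ltry.
pose t := fine (sobolev_dim nu).
have nuE : sobolev_dim nu = t%:E by rewrite fineK.
have t0 : 0 <= t by rewrite -lee_fin -nuE.
have := lt_le_trans nus smu; rewrite nuE.
(* Below the supremum strictly there is room for one [theta] with $t<\dim_{\mathrm
   F}^{\theta}\mu/\theta$. *)
move=> /ereal_sup_gt[_ [theta th <-]] tmu; have /andP[th0 th1] := th.
have {}tmu : ((t * theta)%:E < fourier_spectrum theta mu)%E.
  by rewrite EFinM muleC -lte_pdivlMl// muleC.
have [u tu muoo] := fourier_spectrum_gt (mulr_ge0 t0 (ltW th0)) tmu.
(* With the gap $\delta=u-t\theta>0$ and $b=t-\delta$, the new exponent is
   $t\theta+\delta+(t-\delta)(1-\theta)=t+\delta\theta>t$, while $b<t$ keeps the tail of [nu]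
   finite. *)
pose b := t - (u - t * theta).
have sE : u + b * (1 - theta) = t + (u - t * theta) * theta by rewrite /b; ring.
have ts : t < u + b * (1 - theta) by rewrite sE ltrDl mulr_gt0// subr_gt0.
have s0 : 0 < u + b * (1 - theta) by exact: le_lt_trans ts.
have bnu : (b%:E < sobolev_dim nu)%E.
  by rewrite nuE lte_fin /b ltrBlDr ltrDl subr_gt0.
have oo := energy_convolution_lty th muoo bnu s0.
apply: (@lt_le_trans _ _ (u + b * (1 - theta))%:E); first by rewrite lte_fin.
rewrite /sobolev_dim /fourier_spectrum le_max; apply/orP; right.
by apply: ereal_sup_ubound; exists (u + b * (1 - theta)) => //; split => //; exact: ltW.
Qed.
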